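(* If $\mathfrak{u}=\omega_1$, then indivisible $(\aleph_0,\aleph_1)$-graphs exist. If $\mathfrak{r}>\omega_1$, then no indivisible $(\aleph_0,\aleph_1)$-graph exists.
   Context: An $(\aleph_0,\aleph_1)$-graph is a bipartite graph with bipartition $(A,B)$, $|A|=\aleph_0$, $|B|=\aleph_1$, every vertex of $B$ of infinite degree. An $(\aleph_0,\aleph_1)$-graph with bipartition $(\mathbb{N},B)$ is indivisible if for every partition $\mathbb{N}=A_1\,\dot\cup\, A_2$, only one of the induced subgraphs on $A_1\cup B$ and $A_2\cup B$ contains an $(\aleph_0,\aleph_1)$-graph as a subgraph. The ultrafilter number $\mathfrak{u}$ is the least cardinality of a family $\mathcal{U}\subseteq[\mathbb{N}]^\omega$ which is a base of some non-principal ultrafilter $\mathcal{V}$ on $\mathbb{N}$ (i.e. $\mathcal{U}\subseteq\mathcal{V}$ and every $V\in\mathcal{V}$ contains some $U\in\mathcal{U}$). The reaping number $\mathfrak{r}$ is the least cardinality of a family $\mathcal{R}\subseteq[\mathbb{N}]^\omega$ such that for every infinite $A\subseteq\mathbb{N}$ there is $R\in\mathcal{R}$ with $A\cap R$ finite or $R\setminus A$ finite. *)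

(* Defs.v *)
From mathcomp Require Import all_boot all_order.
From mathcomp Require Import boolp classical_sets functions cardinality filter.

Set Implicit Arguments.
Unset Strict Implicit.
Unset Printing Implicit Defensive.

Local Obligation Tactic := idtac.

Local Open Scope classical_set_scope.
Local Open Scope card_scope.

(** MathComp has no type of cardinals: a cardinal is given by a set that
    realizes it, and cardinals are compared with [#<=] and [#=]. *)

Definition card_lt T U (A : set T) (B : set U) : Prop :=
  A #<= B /\ ~ (B #<= A).

(** aleph_1 = omega_1 is the least uncountable cardinal. *)
Definition is_aleph1 T (A : set T) : Prop :=
  ~ countable A /\
  forall (U : Type) (C : set U), ~ countable C -> A #<= C.

(** [X] is a member of the class [P] whose cardinality is least in [P], so that
    the cardinal "least cardinality of a member of [P]" is the one of [X]. *)
Definition has_least_card T (P : set (set T)) (X : set T) : Prop :=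
  P X /\ forall Y, P Y -> X #<= Y.

Definition nonprincipal (V : set (set nat)) : Prop :=
  forall n, V <> principal_filter n.

Definition ultrafilter_base (U : set (set nat)) : Prop :=
  (forall A, U A -> infinite_set A) /\
  exists V : set (set nat),
    [/\ UltraFilter V, nonprincipal V, U `<=` V
      & forall A, V A -> exists2 C, U C & C `<=` A].

Definition reaping (R : set (set nat)) : Prop :=
  (forall A, R A -> infinite_set A) /\
  forall A : set nat, infinite_set A ->
    exists2 C, R C & finite_set (A `&` C) \/ finite_set (C `\` A).

(** The ultrafilter number is omega_1. *)
Definition u_eq_omega1 : Prop :=
  exists2 U, has_least_card ultrafilter_base U & is_aleph1 U.

(** The reaping number is greater than omega_1. *)
Definition r_gt_omega1 : Prop :=
  exists2 R, has_least_card reaping R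
    & forall (T : Type) (W : set T), is_aleph1 W -> card_lt W R.

(** Simple graphs whose vertices are elements of a type [V]. *)
Record graph (V : Type) := Graph {
  vertices : set V;
  edge : V -> V -> Prop;
  edge_sym : forall x y, edge x y -> edge y x;
  edge_irrefl : forall x, ~ edge x x;
  edge_vertices : forall x y, edge x y -> vertices x }.

Section Graphs.
Variable V : Type.
Implicit Types (G H : graph V) (A B S : set V).

Definition subgraph H G : Prop :=
  vertices H `<=` vertices G /\ forall x y, edge H x y -> edge G x y.

Program Definition induced G S : graph V := {|
  vertices := vertices G `&` S;
  edge := fun x y => [/\ edge G x y, S x & S y] |}.
Next Obligation. by move=> G S x y [xy Sx Sy]; split=> //; apply: edge_sym. Qed.
Next Obligation. by move=> G S x [xx _ _]; apply: (edge_irrefl xx). Qed.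
Next Obligation. by move=> G S x y [xy Sx _]; split=> //; apply: edge_vertices xy. Qed.

Definition bipartition G A B : Prop :=
  [/\ vertices G = A `|` B, A `&` B = set0
    & forall x y, edge G x y -> (A x /\ B y) \/ (B x /\ A y)].

Definition aleph01_graph_with G A B : Prop :=
  [/\ bipartition G A B, A #= [set: nat], is_aleph1 B
    & forall b, B b -> infinite_set [set v | edge G b v]].

Definition aleph01_graph G : Prop := exists A B, aleph01_graph_with G A B.

Definition contains_aleph01_graph G : Prop :=
  exists2 H, subgraph H G & aleph01_graph H.

End Graphs.

(** The vertices of a graph with bipartition (N, B) live in [nat + T], with
    [B : set T], which makes the two sides disjoint. *)
Definition indivisible T (B : set T) (G : graph (nat + T)) : Prop :=
  aleph01_graph_with G (range inl) (inr @` B) /\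
  forall A1 A2 : set nat, A1 `|` A2 = setT -> A1 `&` A2 = set0 ->
    let P1 := contains_aleph01_graph (induced G (inl @` A1 `|` inr @` B)) in
    let P2 := contains_aleph01_graph (induced G (inl @` A2 `|` inr @` B)) in
    (P1 /\ ~ P2) \/ (~ P1 /\ P2).

Definition exists_indivisible : Prop :=
  exists (T : Type) (B : set T) (G : graph (nat + T)), indivisible B G.

(* Main.v *)
Require Import Defs.
From mathcomp Require Import all_boot all_order.
From mathcomp Require Import boolp classical_sets functions cardinality filter.

(** Let [N b] be the neighbourhood of [b] in [B].  A graph with bipartition
    (N, B) contains an aleph-graph on the side of [A] iff [A] meets uncountably
    many [N b] in an infinite set.

    If [u = omega_1], list a base of an ultrafilter as [(U_a)], [a < omega_1],
    and let [N a] be a pseudo-intersection of the countable family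
    [(U_b)], [b < a].  A set [A] of the ultrafilter contains some [U_b], hence
    almost contains [N a] for all but countably many [a], and so the complement
    of [A] meets only countably many [N a] in an infinite set.

    If [r > omega_1], the family of all [N b] is not reaping, and an infinite
    set that splits every [N b] divides the graph. *)

Set Implicit Arguments.
Unset Strict Implicit.
Unset Printing Implicit Defensive.

Local Open Scope classical_set_scope.
Local Open Scope card_scope.

(** * Countability and the cardinal aleph_1 *)

Lemma countableU T (A B : set T) :
  countable A -> countable B -> countable (A `|` B).
Proof.
move=> cA cB.
suff -> : A `|` B = \bigcup_(b in [set: bool]) (if b then A else B).
  by apply: bigcup_countable => // -[].
apply/seteqP; split=> x.
- by case=> Px; [exists true | exists false].
- by move=> [[] _ Px]; [left | right].
Qed.

Lemma countable_image T U (f : T -> U) (A : set T) :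
  countable A -> countable (f @` A).
Proof. by apply: card_le_trans; apply: card_image_le. Qed.

Lemma inj_image_card T U (f : T -> U) (A : set T) :
  injective f -> f @` A #= A.
Proof. by move=> fI; apply: inj_card_eq => x y _ _; apply: fI. Qed.

Lemma countable_enum T (D : set T) (x : T) :
  countable D -> D x -> exists e : nat -> T, D = range e.
Proof.
move=> cD Dx; have := @pfcard_geP _ _ D [set: nat].
move=> /elimT /(_ cD) [D0|[f]]; first by rewrite D0 in Dx.
by exists f; rewrite image_eq.
Qed.

Lemma infinite_image_inj T U (f : T -> U) (A : set T) :
  injective f -> infinite_set A -> infinite_set (f @` A).
Proof.
move=> fI iA /card_le_finite; apply: contra_not iA => H.
by apply: H; have /card_eqPle[] := inj_image_card A fI.
Qed.

Lemma infinite_nat_card (A : set nat) : infinite_set A -> A #= [set: nat].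
Proof.
by move=> iA; apply/card_eqPle; split; [apply: card_leT | apply/infiniteP].
Qed.

Lemma is_aleph1_card_eq T U (A : set T) (B : set U) :
  A #= B -> is_aleph1 A -> is_aleph1 B.
Proof.
move=> /card_eqPle[AB BA] [nA leA]; split=> [cB|W C nC].
- exact/nA/(card_le_trans AB).
- exact: card_le_trans BA (leA _ _ nC).
Qed.

Lemma is_aleph1_sub T (A S : set T) :
  is_aleph1 A -> S `<=` A -> ~ countable S -> is_aleph1 S.
Proof.
move=> [_ leA] SA nS; split=> // W C nC.
exact: card_le_trans (subset_card_le SA) (leA _ _ nC).
Qed.

(** * Chains of countable sets and pseudo-intersections *)

(* A maximal chain of countable sets has an uncountable union: otherwise the
   union together with one more point would extend the chain. *)
Lemma uncountable_chain T (A : set T) : ~ countable A ->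
  exists F : set (set T), [/\ total_on F subset,
    forall c, F c -> countable c & ~ countable (\bigcup_(c in F) c)].
Proof.
move=> nA.
pose P (F : set (set T)) := total_on F subset /\ forall c, F c -> countable c.
have [|F [[totF cF] maxF]] := @Zorn_bigcup _ P.
  move=> FF FP totFF; split=> [c d [F Ff Fc] [G FG Gd]|c [F /FP[_ cF]]];
    last exact: cF.
  by case: (totFF _ _ Ff FG) => FsubG;
    [apply: (FP _ FG).1 => //; apply: FsubG | apply: (FP _ Ff).1 => //; apply: FsubG].
exists F; split=> // cU.
have [x xU] : exists x, ~ (\bigcup_(c in F) c) x.
  by apply/not_existsP => UT; apply: nA; apply: card_le_trans cU;
    apply: subset_card_le => x _; apply: contrapT; apply: UT.
pose c0 := x |` \bigcup_(c in F) c.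
have subc0 c : F c -> c `<=` c0 by move=> Fc y cy; right; exists c.
apply: (maxF (c0 |` F)).
  split=> [c Fc|]; first by right.
  move=> /(_ c0 (or_introl erefl)) Fc0.
  by apply: xU; exists c0 => //; left.
split=> [c d [->|Fc] [->|Fd]|c [->|/cF//]].
- by left.
- by right; apply: subc0.
- by left; apply: subc0.
- exact: totF.
- by apply: countableU => //; apply: countable1.
Qed.

(* The relation plays the role of a well-order of type omega_1. *)
Lemma aleph1_rel T (A : set T) : is_aleph1 A ->
  exists R : T -> T -> Prop,
    (forall v, A v -> countable [set u | A u /\ R u v]) /\
    (forall u, A u -> countable [set v | A v /\ ~ R u v]).
Proof.
move=> [nA leA]; have [F [totF cF nF]] := uncountable_chain nA.
(* By minimality of aleph_1 the uncountable union of the chain maps onto [A]; [f] is a section of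
   that surjection. *)
have [f [fF fI]] : exists f : T -> T,
    (forall v, A v -> exists c, F c /\ c (f v)) /\ {in A &, injective f}.
  have := @pfcard_geP _ _ A (\bigcup_(c in F) c).
  move=> /elimT /(_ (leA _ _ nF)) [A0|[h]]; first by rewrite A0 in nA; case: nA.
  have /choice[f fP] v : exists x, A v -> (\bigcup_(c in F) c) x /\ h x = v.
    have [/(@surj _ _ _ _ h)[x Fx <-]|nAv] := pselect (A v); first by exists x.
    by exists v.
  exists f; split=> [v /fP[[c Fc cfv] _]|x y]; first by exists c.
  by rewrite !inE => /fP[_ {2}<-] /fP[_ {2}<-] ->.
have [c cP] : exists c : T -> set T, forall v, A v -> F (c v) /\ c v (f v).
  have /choice[c cP] v : exists c, A v -> F c /\ c (f v).
    have [/fF[c cP]|nAv] := pselect (A v); first by exists c.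
    by exists set0.
  by exists c.
have inj_pre (X : set T) : countable X -> countable [set u | A u /\ X (f u)].
  move=> cX; apply: card_le_trans cX.
  have /card_eqPle[_] : f @` [set u | A u /\ X (f u)] #= [set u | A u /\ X (f u)].
    by apply: inj_card_eq => x y; rewrite !inE => -[Ax _] [Ay _]; apply: fI; rewrite inE.
  by move/card_le_trans; apply; apply: subset_card_le => _ [u [_ Xu] <-].
(* With [c v] a member of the chain containing [f v], [u] precedes [v] when [c v] already contains
   [f u]. *)
exists (fun u v => c v (f u)); split=> [v Av|u Au].
  by apply: inj_pre; apply: cF; case: (cP v Av).
have [Fcu cuu] := cP u Au.
apply: card_le_trans (inj_pre _ (cF _ Fcu)); apply: subset_card_le => v /=.
move=> [Av nv]; split=> //; have [Fcv cvv] := cP v Av.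
(* If [f u] is not in [c v], the chain forces [c v] inside [c u], so [f v] lies in the countable set
   [c u]. *)
by case: (totF _ _ Fcu Fcv) => sub; [case: nv; apply: sub | apply: sub].
Qed.

(** Diagonalization: finite intersections of members of [D] stay in [V], hence are infinite, and one
    picks a point at least [n] in the [n]-th of them. *)
Lemma pseudo_intersection (V : set (set nat)) (D : set (set nat)) :
  Filter V -> (forall A, V A -> infinite_set A) ->
  countable D -> D `<=` V ->
  exists2 N, infinite_set N & forall A, D A -> finite_set (N `\` A).
Proof.
move=> FV iV cD DV.
(* Adding [setT] makes the family nonempty, so that it can be enumerated even when [D] is empty. *)
have [e eD] : exists e : nat -> set nat, setT |` D = range e.
  by apply: (@countable_enum _ _ setT); [apply: countableU (countable1 _) cD|left].
have Ve n : V (e n).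
  have : (setT |` D) (e n) by rewrite eD; exists n.
  by case=> [->|/DV//]; apply: filterT.
pose I := fix I n := if n is m.+1 then I m `&` e n else e 0.
have VI n : V (I n) by elim: n => [|n IH] /=; [|apply: filterI].
have Ie m n : m <= n -> I n `<=` e m.
  elim: n => [|n IH]; first by rewrite leqn0 => /eqP->.
  by rewrite leq_eqVlt => /orP[/eqP->|/IH sub] x [] // /sub.
have /choice[g gP] n : exists x, n <= x /\ I n x.
  apply: contrapT => /forallNP nP; apply: (iV _ (VI n)).
  apply: sub_finite_set (finite_II n) => x Ix /=; rewrite ltnNge.
  by apply/negP => nx; apply: (nP x).
exists (range g).
  move=> /finite_seqP[s gs].
  have : (range g) (g (\max_(x <- s) x).+1) by exists (\max_(x <- s) x).+1.
  rewrite gs /= => /(@leq_bigmax_seq nat s xpredT id _) /(_ isT) gmax.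
  by have := leq_trans (gP (\max_(x <- s) x).+1).1 gmax; rewrite ltnn.
move=> A DA; have [n _ <-] : range e A by rewrite -eD; right.
(* Only the points [g k] with [k < n] can lie outside [e n]. *)
apply: sub_finite_set (finite_image g (finite_II n)) => _ [[k _ <-] ng].
exists k => //=; rewrite ltnNge; apply/negP => nk; apply: ng.
exact: Ie nk _ (gP k).2.
Qed.

(** * Neighbourhoods and aleph-subgraphs *)

Section Neighbourhoods.
Variables (T : Type) (B : set T) (G : graph (nat + T)).
Hypothesis GP : aleph01_graph_with G (range inl) (inr @` B).

Definition nbhd (b : T) : set nat := [set n | edge G (inr b) (inl n)].

Lemma edge_inr b v : edge G (inr b) v -> exists2 n, v = inl n & nbhd b n.
Proof.
move=> ev; have [[_ _ /(_ _ _ ev)]] := GP.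
by case=> [[[n _ //]]|[_ [n _ nv]]] _ _ _; exists n; rewrite // /nbhd /= nv.
Qed.

Lemma nbhd_infinite b : B b -> infinite_set (nbhd b).
Proof.
move=> Bb; have [_ _ _ /(_ (inr b) (imageP _ Bb)) iN] := GP.
apply: contra_not iN => fN; apply: sub_finite_set (finite_image inl fN).
by move=> v /edge_inr[n -> Nn]; exists n.
Qed.

Lemma is_aleph1_side : is_aleph1 B.
Proof.
have [_ _ aB _] := GP; apply: is_aleph1_card_eq aB.
by apply: inj_image_card => x y [].
Qed.

Lemma contains_aleph01P (A : set nat) :
  contains_aleph01_graph (induced G (inl @` A `|` inr @` B)) <->
  ~ countable [set b | B b /\ infinite_set (nbhd b `&` A)].
Proof.
set S := [set b | _]; split.
  move=> [H [HG eHG]] [A' [B' [[vH _ _] _ [nB' _] iB']]] cS; apply: nB'.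
  (* The bipartition of [H] need not follow that of [G]: [B'] may contain natural numbers, but only
     countably many. Its other vertices have infinite degree inside [A], hence come from [S]. *)
  apply: (@sub_countable _ _ _ (range inl `|` inr @` S)); last first.
    apply: countableU; last exact: countable_image cS.
    exact: (@countable_image nat _ inl setT (card_lexx _)).
  apply: subset_card_le => v B'v.
  have [_ Sv] : vertices (induced G (inl @` A `|` inr @` B)) v.
    by apply: HG; rewrite vH; right.
  case: Sv B'v => [[n _ <-]|[b Bb <-]] B'v; first by left; exists n.
  right; exists b => //; split=> // fN; apply: (iB' _ B'v).
  apply: sub_finite_set (finite_image inl fN) => w /eHG[/edge_inr[n -> Nn] _].
  by case=> [[m Am [mn]]|[? _ //]]; exists n => //; split=> //; rewrite -mn.
move=> nS.
have SB : S `<=` B by move=> b [].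
have vG : vertices G = range inl `|` inr @` B by case: GP => -[].
(* Discarding the vertices outside [S] leaves only infinite degrees on that side. *)
exists (induced G (inl @` A `|` inr @` S)).
  split=> [v [Gv Sv]|v w [evw Sv Sw]]; split=> //.
  - by case: Sv => [|[b /SB Bb <-]]; [left|right; exists b].
  - by case: Sv => [|[b /SB Bb <-]]; [left|right; exists b].
  - by case: Sw => [|[b /SB Bb <-]]; [left|right; exists b].
exists (inl @` A), (inr @` S); split.
- split.
  + rewrite /= vG; apply/setIidr => v [[n _ <-]|[b /SB Bb <-]].
      by left; exists n.
    by right; exists b.
  + by rewrite -subset0 => v [[n _ <-] [b _ ]].
  + move=> v w [evw Sv Sw]; have [[_ _ /(_ _ _ evw)]] := GP.
    move=> ends _ _ _; case: ends => -[[x _ xv] [y _ yw]]; subst v w.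
      by left; split; [case: Sv => // -[? _ //]|case: Sw => // -[? _ //]].
    by right; split; [case: Sv => // -[? _ //]|case: Sw => // -[? _ //]].
- have iA : infinite_set A.
    have [b [_ iNA]] : S !=set0.
      by apply/set0P/eqP => S0; apply: nS; rewrite S0; apply: countable0.
    by apply: sub_infinite_set iNA => n [].
  apply: card_eq_trans (infinite_nat_card iA).
  by apply: inj_image_card => x y [].
- apply: (@is_aleph1_card_eq _ _ S).
    by rewrite card_eq_sym; apply: inj_image_card => x y [].
  exact: is_aleph1_sub is_aleph1_side SB nS.
- move=> _ [b Sb <-]; have [Bb iNA] := Sb.
  apply: sub_infinite_set (infinite_image_inj (f := inl) _ iNA); last first.
    by move=> x y [].
  by move=> _ [n [Nn An] <-]; split=> //; [right; exists b|left; exists n].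
Qed.

End Neighbourhoods.

(** * The graph with prescribed neighbourhoods *)

Section NeighbourhoodGraph.
Variables (T : Type) (B : set T) (N : T -> set nat).

Definition nbhd_edge (x y : nat + T) : Prop :=
  match x, y with
  | inl n, inr b | inr b, inl n => B b /\ N b n
  | _, _ => False
  end.

Lemma nbhd_edge_sym x y : nbhd_edge x y -> nbhd_edge y x.
Proof. by move: x y => [n|b] [m|c]. Qed.

Lemma nbhd_edge_irrefl x : ~ nbhd_edge x x.
Proof. by move: x => [n|b]. Qed.

Lemma nbhd_edge_vertices x y :
  nbhd_edge x y -> (range inl `|` inr @` B) x.
Proof. by case: x y => [n|b] [m|c] //= [Bb _]; [left; exists n|right; exists b]. Qed.

Definition nbhd_graph : graph (nat + T) :=
  Graph nbhd_edge_sym nbhd_edge_irrefl nbhd_edge_vertices.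

Lemma nbhd_graph_aleph01 : is_aleph1 B -> (forall b, B b -> infinite_set (N b)) ->
  aleph01_graph_with nbhd_graph (range inl) (inr @` B).
Proof.
move=> aB iN; split.
- split=> //.
  + by rewrite -subset0 => v [[n _ <-] [b _]].
  + move=> [n|b] [m|c] //= [Bb _].
      by left; split; [exists n|exists c].
    by right; split; [exists b|exists m].
- by apply: inj_image_card => x y [].
- apply: (is_aleph1_card_eq _ aB).
  by rewrite card_eq_sym; apply: inj_image_card => x y [].
- move=> _ [b Bb <-].
  apply: sub_infinite_set (infinite_image_inj (f := inl) _ (iN _ Bb)); last first.
    by move=> x y [].
  by move=> _ [n Nn <-].
Qed.

End NeighbourhoodGraph.

(** * The two implications *)

Lemma u_eq_omega1_indivisible : u_eq_omega1 -> exists_indivisible.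
Proof.
move=> [U [[iU [V [ultraV _ UV baseV]]] _] aU].
have iV A : V A -> infinite_set A.
  move=> VA fA; have [C UC CA] := baseV _ VA.
  exact: iU UC (sub_finite_set CA fA).
have [R [cR cnR]] := aleph1_rel aU.
(* The base indexes itself: its members are the vertices of the uncountable side, and [N v] is a
   pseudo-intersection of the countably many members that precede [v]. Outside [U] the value [setT]
   is a dummy. *)
have /choice[N NP] v : exists N : set nat, U v -> infinite_set N /\
    forall A, U A -> R A v -> finite_set (N `\` A).
  have [Uv|nUv] := pselect (U v); last by exists setT.
  have [|N iN NP] := @pseudo_intersection V _ _ iV (cR v Uv).
    by move=> A [/UV].
  by exists N => _; split=> // A UA RA; apply: NP.
have GP : aleph01_graph_with (nbhd_graph U N) (range inl) (inr @` U).
  by apply: nbhd_graph_aleph01 => // v /NP[].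
exists (set nat), U, (nbhd_graph U N); split=> // A1 A2 A12T A12 P1 P2.
have negl A A' : A `&` A' = set0 -> V A ->
    ~ contains_aleph01_graph (induced (nbhd_graph U N) (inl @` A' `|` inr @` U)).
  move=> AA' VA /(contains_aleph01P GP); apply.
  have [C UC CA] := baseV _ VA.
  (* Since [C] misses [A'], the trace of [N v] on [A'] lies in [N v] minus [C], which is finite as
     soon as [C] precedes [v]. *)
  apply: card_le_trans (cnR C UC); apply: subset_card_le => v [Uv iN].
  split=> // RCv; apply: iN; apply: sub_finite_set ((NP v Uv).2 _ UC RCv).
  move=> n [[_ Nn] A'n]; split=> // /CA An.
  by have : (A `&` A') n by []; rewrite AA'.
(* Each infinite [N v] has an infinite trace on [A] or on [A'], and the uncountable [U] is not a
   union of two countable sets. *)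
have pos A A' : A `|` A' = setT ->
    contains_aleph01_graph (induced (nbhd_graph U N) (inl @` A `|` inr @` U)) \/
    contains_aleph01_graph (induced (nbhd_graph U N) (inl @` A' `|` inr @` U)).
  move=> AA'; apply: contrapT => /not_orP[].
  move=> /(contains_aleph01P GP)/contrapT cA /(contains_aleph01P GP)/contrapT cA'.
  case: aU => + _; apply; apply: card_le_trans (countableU cA cA').
  apply: subset_card_le => v Uv.
  apply: contrapT => /not_orP[/not_andP[//|/contrapT fA] /not_andP[//|/contrapT fA']].
  apply: (nbhd_infinite GP Uv).
  by rewrite -[nbhd _ _]setIT -AA' setIUr finite_setU.
have [VA1|VA2] := in_ultra_setVsetC A1 ultraV.
  have nP2 := negl _ _ A12 VA1.
  by left; split=> //; case: (pos _ _ A12T) => // /nP2.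
have A2C : V A2.
  apply: filterS VA2 => n nA1.
  by have : (A1 `|` A2) n; [rewrite A12T|case].
rewrite setIC in A12; have nP1 := negl _ _ A12 A2C.
by right; split=> //; case: (pos _ _ A12T) => // /nP1.
Qed.

Lemma r_gt_omega1_divisible : r_gt_omega1 -> ~ exists_indivisible.
Proof.
move=> [R [_ leR] Rgt] [T [B [G [GP indiv]]]].
have aB := is_aleph1_side GP.
have [_ nRB] := Rgt _ _ aB.
(* The neighbourhoods number at most aleph_1, fewer than any reaping family has. *)
have [] : ~ reaping (nbhd G @` B).
  by move=> /leR RN; apply: nRB; apply: card_le_trans RN (card_image_le _ _).
split=> [_ [b Bb <-]|A iA]; first exact: nbhd_infinite GP _ Bb.
(* A set [A] that no neighbourhood reaps splits them all, so both [A] and its complement carry an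
   aleph-subgraph, against indivisibility. *)
apply: contrapT => /forall2NP nR.
have all_split A' : (forall b, B b -> infinite_set (nbhd G b `&` A')) ->
    contains_aleph01_graph (induced G (inl @` A' `|` inr @` B)).
  move=> iA'; apply/(contains_aleph01P GP) => cS; case: aB => + _; apply.
  by apply: card_le_trans cS; apply: subset_card_le => b Bb; split=> //; apply: iA'.
have sp b : B b -> ~ finite_set (A `&` nbhd G b) /\ ~ finite_set (nbhd G b `\` A).
  by move=> Bb; apply/not_orP; case: (nR (nbhd G b)) => // -[]; exists b.
have := indiv A (~` A) (setUv A) (setICr A) => /=.
case=> -[]; last by move=> nP1 _; apply/nP1/all_split => b /sp[]; rewrite setIC.
by move=> _; apply; apply: all_split => b /sp[].
Qed.

Theorem theorem6p1 :
  (u_eq_omega1 -> exists_indivisible) /\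
  (r_gt_omega1 -> ~ exists_indivisible).
Proof.
by split; [apply: u_eq_omega1_indivisible | apply: r_gt_omega1_divisible].
Qed.
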